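(* Let $P$ be a set of qubits and consider a Clifford monitored circuit on $P$ with fixed two-qubit Clifford gates and fixed locations of single-qubit Pauli-$Z$ measurements. For each measurement-outcome record $\mathbf{m}\in\{0,1\}^{|M|}$ let $C_{\mathbf{m}}$ be the corresponding product of the Clifford unitaries and outcome projectors $\frac{1\pm Z_i}{2}$, and let $p_{\mathbf{m}}=2^{-|P|}\operatorname{tr}(C_{\mathbf{m}}C_{\mathbf{m}}^\dagger)$. Let $M$ be a register of $|M|$ qubits recording the outcomes and define the quantum channel from $P$ to $P\cup M$ $$\mathcal{E}_C(\rho)=\sum_{\mathbf{m}\in\{0,1\}^{|M|}}|\mathbf{m}\rangle\langle\mathbf{m}|_M\otimes C_{\mathbf{m}}\rho C_{\mathbf{m}}^\dagger .$$ Let $R$ be a reference copy of $P$ and, for each $\mathbf m$ with $p_{\mathbf m}\neq 0$, let $|\phi_{\mathbf{m}}\rangle\propto\sum_{\mathbf{s}}(C_{\mathbf{m}}|\mathbf{s}\rangle)_P\otimes|\mathbf{s}\rangle_R$ (normalized). For $A,B\subseteq P$, let $A_R\subseteq R$ be the copy of $A$. Then for every $\mathbf m$ with $p_{\mathbf m}\neq0$, $$I_{A_R:B_P}(|\phi_{\mathbf{m}}\rangle)=\log_2 H_{A\rightarrow B\cup M}(\mathcal{E}_C)-\log_2 H_{A\rightarrow M}(\mathcal{E}_C).$$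
   Context: Mutual information is $I_{X:Y}=S_X+S_Y-S_{XY}$ with von Neumann entropies in base 2. For a channel $\mathcal{E}$ from $P$ to $Q$ and subsets $A\subseteq P$, $S\subseteq Q$, define $$H_{A\rightarrow S}(\mathcal{E})=\big|\{O\in\mathcal{P}_A:\exists\,\tilde{O}_S\in\mathcal{P}_S\text{ with }O=\mathcal{E}^\dagger(\tilde{O}_S)\}\big|,$$ where $\mathcal{E}^\dagger$ is the adjoint (Heisenberg-picture) map, $\mathcal{P}_A$ denotes the Pauli strings supported on $A$ (tensor products of $I,X,Y,Z$ on $A$, identity elsewhere, with coefficient $+1$) and $\mathcal{P}_S$ denotes the Pauli operators supported on $S$ (such tensor products with a sign $\pm1$). *)

(* Defs.v *)
From HB Require Import structures.
From mathcomp Require Import all_boot all_order all_algebra.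
From mathcomp Require Import boolp classical_sets reals exp.
From mathcomp Require Import complex.
Set Implicit Arguments. Unset Strict Implicit. Unset Printing Implicit Defensive.
Import Order.TTheory GRing.Theory Num.Theory.
Local Open Scope ring_scope.

Section QDefs.
Variable R : realType.
Local Notation C := (complex R).

(* computational-basis configurations of a finite set X of qubits *)
Definition cfg (X : finType) := {ffun X -> bool}.
(* operators on the Hilbert space (C^2)^{tensor X}, given by matrix entries *)
Definition op (X : finType) := cfg X -> cfg X -> C.

Definition opmul (X : finType) (A B : op X) : op X := fun s t => \sum_(u : cfg X) A s u * B u t.
Definition opadj (X : finType) (A : op X) : op X := fun s t => conjc (A t s).
Definition optr (X : finType) (A : op X) : C := \sum_(s : cfg X) A s s.
Definition op1 (X : finType) : op X := fun s t => (s == t)%:R.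
Definition opscale (X : finType) (a : C) (A : op X) : op X := fun s t => a * A s t.
Definition unit_op (X : finType) (s t : cfg X) : op X := fun a b => ((a == s) && (b == t))%:R.

(* single-qubit Paulis: 0 = I, 1 = X, 2 = Y, 3 = Z; entries <b|sigma|c> (false = |0>) *)
Definition pauli1 (a : 'I_4) (b c : bool) : C :=
  match val a with
  | 0%N => (b == c)%:R
  | 1%N => (b != c)%:R
  | 2%N => if b == c then 0 else if b then Complex 0 1 else Complex 0 (-1)
  | _ => if b == c then (if b then -1 else 1) else 0
  end.
Definition pstr (X : finType) (f : {ffun X -> 'I_4}) : op X :=
  fun s t => \prod_(x : X) pauli1 (f x) (s x) (t x).
Definition psupport (X : finType) (f : {ffun X -> 'I_4}) : {set X} := [set x | f x != 0%R].

Definition unitary (X : finType) (U : op X) : Prop := opmul U (opadj U) = @op1 X.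
Definition clifford2 (U : op 'I_2) : Prop :=
  unitary U /\
  forall f : {ffun 'I_2 -> 'I_4}, exists g : {ffun 'I_2 -> 'I_4}, exists k : 'I_4,
    opmul (opmul U (pstr f)) (opadj U) = opscale ((Complex 0 1) ^+ k) (pstr g).

Definition embed2 (P : finType) (i j : P) (U : op 'I_2) : op P :=
  fun s t => if [forall k, ((k != i) && (k != j)) ==> (s k == t k)]
             then U [ffun k : 'I_2 => s (if k == ord0 then i else j)]
                    [ffun k : 'I_2 => t (if k == ord0 then i else j)]
             else 0.

(* outcome projector (1 + (-1)^b Z_i)/2 = |b><b|_i *)
Definition zproj (P : finType) (i : P) (b : bool) : op P :=
  fun s t => ((s == t) && (s i == b))%:R.

Inductive step (P : finType) :=
| Gate of P & P & op 'I_2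
| Meas of P.

Definition valid_step (P : finType) (st : step P) : Prop :=
  match st with Gate i j U => i != j /\ clifford2 U | Meas _ => True end.
Fixpoint valid_circuit (P : finType) (c : seq (step P)) : Prop :=
  match c with [::] => True | st :: c' => valid_step st /\ valid_circuit c' end.

Fixpoint nmeas (P : finType) (c : seq (step P)) : nat :=
  match c with
  | [::] => 0%N
  | Gate _ _ _ :: c' => nmeas c'
  | Meas _ :: c' => (nmeas c').+1
  end.

(* product of operators; later steps multiply on the left; the k-th measurement
   (counted from 0 in time order) uses outcome m k *)
Fixpoint circ_op (P : finType) (c : seq (step P)) (k : nat) (m : nat -> bool) : op P :=
  match c with
  | [::] => @op1 P
  | Gate i j U :: c' => opmul (circ_op c' k m) (embed2 i j U)
  | Meas i :: c' => opmul (circ_op c' k.+1 m) (zproj i (m k))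
  end.

Definition Cm (P : finType) (c : seq (step P)) (m : {ffun 'I_(nmeas c) -> bool}) : op P :=
  circ_op c 0 (fun k => if (insub k : option 'I_(nmeas c)) is Some i then m i else false).

Definition prob (P : finType) (c : seq (step P)) (m : {ffun 'I_(nmeas c) -> bool}) : C :=
  (2%:R ^- #|P|) * optr (opmul (Cm m) (opadj (Cm m))).

Definition lpart (X Y : finType) (s : cfg (X + Y)%type) : cfg X := [ffun x => s (inl x)].
Definition rpart (X Y : finType) (s : cfg (X + Y)%type) : cfg Y := [ffun y => s (inr y)].
Definition tens (X Y : finType) (A : op X) (B : op Y) : op (X + Y)%type :=
  fun s t => A (lpart s) (lpart t) * B (rpart s) (rpart t).

Definition chanC (P : finType) (c : seq (step P)) (rho : op P) : op (P + 'I_(nmeas c))%type :=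
  fun s t => \sum_(m : {ffun 'I_(nmeas c) -> bool})
     tens (opmul (opmul (Cm m) rho) (opadj (Cm m))) (unit_op m m) s t.

(* Heisenberg-picture adjoint of a linear map E w.r.t. the Hilbert-Schmidt product:
   tr(hadj E O ^dagger rho) = tr(O^dagger E rho) *)
Definition hadj (X Y : finType) (E : op X -> op Y) (O : op Y) : op X :=
  fun s t => optr (opmul (opadj (E (unit_op s t))) O).

Definition Hcount (X Y : finType) (E : op X -> op Y) (A : {set X}) (S : {set Y}) : nat :=
  #|[set f : {ffun X -> 'I_4} | (psupport f \subset A) &&
     `[< exists g : {ffun Y -> 'I_4}, psupport g \subset S /\
          exists sg : bool, pstr f = hadj E (opscale ((-1) ^+ sg) (pstr g)) >] ]|.

(* the normalized Choi-type state |phi_m> on P + R (inl = P, inr = R) as a density matrix *)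
Definition phi_vec (P : finType) (c : seq (step P)) (m : {ffun 'I_(nmeas c) -> bool}) : cfg (P + P)%type -> C :=
  fun x => Cm m (lpart x) (rpart x).
Definition rho_phi (P : finType) (c : seq (step P)) (m : {ffun 'I_(nmeas c) -> bool}) : op (P + P)%type :=
  fun s t => phi_vec m s * conjc (phi_vec m t) /
             (\sum_(x : cfg (P + P)%type) phi_vec m x * conjc (phi_vec m x)).

Definition subq (Z : finType) (Y : {set Z}) : finType := {z : Z | z \in Y}.
Definition restr (Z : finType) (Y : {set Z}) (s : cfg Z) : cfg (subq Y) := [ffun y => s (val y)].
Definition ptrace (Z : finType) (Y : {set Z}) (rho : op Z) : op (subq Y) :=
  fun a b => \sum_(s : cfg Z) \sum_(t : cfg Z |
      [&& @restr Z Y s == a, @restr Z Y t == b & [forall z, (z \notin Y) ==> (s z == t z)]])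
      rho s t.

Definition log2 (x : R) : R := ln x / ln 2%:R.
Definition xlog2 (x : R) : R := if x == 0 then 0 else x * log2 x.
Definition mxop (T : finType) (A : op T) : 'M[C]_(#|{: cfg T}|) :=
  \matrix_(i, j) A (enum_val i) (enum_val j).
Definition vN_entropy (T : finType) (A : op T) : R :=
  xget 0 (fun v : R => exists rs : seq C,
     char_poly (mxop A) = \prod_(z <- rs) ('X - z%:P) /\
     v = - \sum_(z <- rs) xlog2 (@complex.Re R z)).

Definition entropy (Z : finType) (Y : {set Z}) (rho : op Z) : R := vN_entropy (@ptrace Z Y rho).
Definition mutinf (Z : finType) (X Y : {set Z}) (rho : op Z) : R :=
  entropy X rho + entropy Y rho - entropy (X :|: Y) rho.

End QDefs.

(* Main.v *)
Require Import Defs.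
From HB Require Import structures.
From mathcomp Require Import all_boot all_order all_algebra.
From mathcomp Require Import boolp classical_sets reals exp.
From mathcomp Require Import complex.
From mathcomp Require Import ring.
Set Implicit Arguments. Unset Strict Implicit. Unset Printing Implicit Defensive.
Import Order.TTheory GRing.Theory Num.Theory.
Local Open Scope ring_scope.

(** For Pauli strings [g], [f] call [(g, f)] a stabilizer of the Kraus operator [C_m] when
    [g C_m = +-C_m f]; these pairs are the stabilizer group of [phi_m].  By induction on the
    circuit, [tr (C_m^* g C_m f)] either vanishes or [g C_m' = +-C_m' f] holds for all outcome
    records [m'] at once, with signs [(-1)^(a.m')] that are linear in [m'].  A linear sign is the
    diagonal of a [Z]-string on the register, so, since [sum_m C_m^* C_m = 1], the strings [f]
    on [A] of the form [E^dagger (+-g (x) Z^a)] with [g] on [B] are exactly those that have a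
    stabilizing partner [g] on [B].  Projecting the stabilizer pairs supported on [(B, A)] to
    [f] gives [|G_AB| = H_(A -> B u M) |G_B|], and [|G_A| = H_(A -> M)].  Finally a reduced
    stabilizer state [rho_Y] satisfies [rho_Y^2 = 2^(-|Y|) |G_Y| rho_Y], so that its entropy is
    [|Y| - log2 |G_Y|]. *)

(** * Operator algebra *)

Local Notation "A *o B" := (opmul A B) (at level 40, left associativity).

Section Ops.
Variable R : realType.
Local Notation C := (complex R).
Section X.
Variable X : finType.
Implicit Types A B D : op R X.

Lemma opP A B : (forall s t, A s t = B s t) -> A = B.
Proof. by move=> h; apply/funext => s; apply/funext => t. Qed.

Lemma opmulA A B D : A *o (B *o D) = A *o B *o D.
Proof.
apply: opP => s t; rewrite /opmul.
under eq_bigr do rewrite big_distrr /=.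
under [RHS]eq_bigr do rewrite big_distrl /=.
rewrite exchange_big /=; apply: eq_bigr => u _.
by apply: eq_bigr => v _; rewrite mulrA.
Qed.

Lemma opmul1 A : A *o @op1 R X = A.
Proof.
apply: opP => s t; rewrite /opmul /op1 (bigD1 t) //= eqxx mulr1 big1 ?addr0 //.
by move=> u /negbTE ->; rewrite mulr0.
Qed.

Lemma op1mul A : @op1 R X *o A = A.
Proof.
apply: opP => s t; rewrite /opmul /op1 (bigD1 s) //= eqxx mul1r big1 ?addr0 //.
by move=> u; rewrite eq_sym => /negbTE ->; rewrite mul0r.
Qed.

Lemma opmulZl a A B : opscale a A *o B = opscale a (A *o B).
Proof.
by apply: opP => s t; rewrite /opmul /opscale big_distrr /=; apply: eq_bigr => u _; rewrite mulrA.
Qed.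

Lemma opmulZr a A B : A *o opscale a B = opscale a (A *o B).
Proof.
by apply: opP => s t; rewrite /opmul /opscale big_distrr /=; apply: eq_bigr => u _; rewrite mulrCA.
Qed.

Lemma opscaleA a b A : opscale a (opscale b A) = opscale (a * b) A.
Proof. by apply: opP => s t; rewrite /opscale mulrA. Qed.

Lemma opscale1 A : opscale 1 A = A.
Proof. by apply: opP => s t; rewrite /opscale mul1r. Qed.

Lemma optrC A B : optr (A *o B) = optr (B *o A).
Proof.
rewrite /optr /opmul exchange_big /=.
by apply: eq_bigr => s _; apply: eq_bigr => t _; rewrite mulrC.
Qed.

Lemma optrZ a A : optr (opscale a A) = a * optr A.
Proof. by rewrite /optr /opscale big_distrr. Qed.

Lemma opadjM A B : opadj (A *o B) = opadj B *o opadj A.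
Proof.
apply: opP => s t; rewrite /opadj /opmul rmorph_sum /=.
by apply: eq_bigr => u _; rewrite rmorphM mulrC.
Qed.

Lemma opadj1 : opadj (@op1 R X) = @op1 R X.
Proof. by apply: opP => s t; rewrite /opadj /op1 rmorph_nat eq_sym. Qed.

Lemma mxopM A B : mxop (A *o B) = mxop A *m mxop B.
Proof.
apply/matrixP => i j; rewrite !mxE /opmul.
rewrite (reindex (@enum_val (cfg X) predT)) /=; last exact/onW_bij/enum_val_bij.
by apply: eq_bigr => k _; rewrite !mxE.
Qed.

Lemma mxop1 : mxop (@op1 R X) = 1%:M.
Proof. by apply/matrixP => i j; rewrite !mxE /op1 (inj_eq enum_val_inj). Qed.

Lemma mxop_inj A B : mxop A = mxop B -> A = B.
Proof.
move=> /matrixP h; apply: opP => s t.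
by have := h (enum_rank s) (enum_rank t); rewrite !mxE !enum_rankK.
Qed.

Lemma mxtrace_mxop A : \tr (mxop A) = optr A.
Proof.
rewrite /mxtrace /optr (reindex (@enum_val (cfg X) predT)) /=; last exact/onW_bij/enum_val_bij.
by apply: eq_bigr => k _; rewrite !mxE.
Qed.

(** Finite dimension makes a one-sided inverse two-sided; [mxop] carries this fact over from square
    matrices. *)
Lemma opmul1C A B : A *o B = @op1 R X -> B *o A = @op1 R X.
Proof.
move=> h; apply: mxop_inj; rewrite mxopM mxop1.
by apply: mulmx1C; rewrite -mxopM h mxop1.
Qed.

End X.
End Ops.

(** * Pauli strings *)

(** Product of Paulis up to phase, the Klein four-group on the labels 0 to 3. Two distinct labels
    among 1, 2, 3 multiply to the remaining one, which is [6 - a - b] because 1 + 2 + 3 = 6. *)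
Definition pauli_xor (a b : 'I_4) : 'I_4 :=
  if a == 0 then b else if b == 0 then a else if a == b then 0 else inZp (6 - a - b).
Definition pstr_xor (X : finType) (f g : {ffun X -> 'I_4}) := [ffun x => pauli_xor (f x) (g x)].

Section Pauli.
Variable R : realType.
Local Notation C := (complex R).

(** The cyclic rules XY = iZ, YZ = iX, ZX = iY give the factor i; the reversed products give -i. *)
Definition pauli_phase (a b : 'I_4) : C :=
  if [|| a == 0, b == 0 | a == b] then 1
  else if (a.+1 == b) || ((a == 3 :> nat) && (b == 1 :> nat)) then Complex 0 1
  else Complex 0 (-1).

Lemma pauli_xorK a b : pauli_xor (pauli_xor a b) b = a.
Proof.
by apply/val_inj; case: a => [[|[|[|[|//]]]] ?]; case: b => [[|[|[|[|//]]]] ?].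
Qed.

Lemma pauli_xor_eq0 a b : (pauli_xor a b == 0) = (a == b).
Proof. by case: a => [[|[|[|[|//]]]] ?]; case: b => [[|[|[|[|//]]]] ?]. Qed.

Lemma pauli_phase_neq0 a b : pauli_phase a b != 0.
Proof.
have h (z : R) : z != 0 -> Complex 0 z != 0 by move=> h; rewrite eq_complex /= negb_and h orbT.
by rewrite /pauli_phase; case: ifP => _; [exact: oner_neq0|case: ifP => _; apply: h; rewrite ?oppr_eq0 oner_neq0].
Qed.

Lemma pauli_phase_id a : pauli_phase a a = 1.
Proof. by rewrite /pauli_phase eqxx !orbT. Qed.

Lemma pauli1M a b (s t : bool) :
  \sum_(u : bool) pauli1 R a s u * pauli1 R b u t = pauli_phase a b * pauli1 R (pauli_xor a b) s t.
Proof.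
rewrite big_bool /pauli1 /pauli_phase.
by case: a => [[|[|[|[|//]]]] ?]; case: b => [[|[|[|[|//]]]] ?]; case: s; case: t => /=;
  rewrite ?(mul0r, mulr0, mul1r, mulr1, addr0, add0r, mulrN, mulNr, oppr0, opprK) //;
  apply/eqP; rewrite eq_complex /= ?(mul0r, mulr0, mul1r, mulr1, addr0, add0r, sub0r, subr0, mulrN, mulNr, oppr0, opprK) !eqxx.
Qed.

Lemma pauli1T a (s t : bool) : pauli1 R a t s = (-1) ^+ (a == 2 :> nat) * pauli1 R a s t.
Proof.
by rewrite /pauli1; case: a => [[|[|[|[|//]]]] ?]; case: s; case: t => /=;
  rewrite ?expr0 ?expr1 ?mul1r ?mulN1r ?oppr0 //; apply/eqP; rewrite eq_complex /= ?oppr0 ?opprK ?eqxx.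
Qed.

(** Completeness of the Pauli basis: the sum of [sigma_a] tensor [sigma_a] is twice the swap of two
    qubits. *)
Lemma pauli1_compl (u v s t : bool) :
  \sum_(a : 'I_4) pauli1 R a u v * pauli1 R a s t = 2 * ((v == s) && (u == t))%:R.
Proof.
rewrite !big_ord_recl big_ord0 /pauli1 /=.
by case: u; case: v; case: s; case: t => /=;
  apply/eqP; rewrite eq_complex /= ?(mul0r, mulr0, mul1r, mulr1, addr0, add0r, sub0r, subr0, mulrN, mulNr, oppr0, opprK, subrr, addrN, addNr) ?eqxx.
Qed.

(** Distributivity, which reduces identities between Pauli strings to one-qubit identities at each
    site. *)
Lemma sum_cfg_prod (X J : finType) (F : X -> J -> C) :
  \sum_(u : {ffun X -> J}) \prod_x F x (u x) = \prod_x \sum_b F x b.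
Proof. by rewrite bigA_distr_bigA. Qed.

Section X.
Variable X : finType.
Implicit Types f g h : {ffun X -> 'I_4}.
Local Notation P := (@pstr R X).

Definition pstr_phase f g : C := \prod_x pauli_phase (f x) (g x).

Lemma pstr_phase_neq0 f g : pstr_phase f g != 0.
Proof. by apply/prodf_neq0 => x _; apply: pauli_phase_neq0. Qed.

Lemma pstrM f g : P f *o P g = opscale (pstr_phase f g) (P (pstr_xor f g)).
Proof.
apply: opP => s t; rewrite /opscale /pstr_phase -big_split /=.
transitivity (\sum_(u : {ffun X -> bool}) \prod_x (pauli1 R (f x) (s x) (u x) * pauli1 R (g x) (u x) (t x))).
  by apply: eq_bigr => u _; rewrite -big_split.
rewrite (sum_cfg_prod (fun x b => pauli1 R (f x) (s x) b * pauli1 R (g x) b (t x))).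
by apply: eq_bigr => x _; rewrite pauli1M ffunE.
Qed.

Lemma prod_natb (p : pred X) : \prod_x ((p x)%:R : C) = [forall x, p x]%:R.
Proof.
case: (boolP [forall x, p x]) => [/forallP h|].
  by rewrite big1 // => x _; rewrite h.
by rewrite negb_forall => /existsP [x /negbTE hx]; rewrite (bigD1 x) //= hx mul0r.
Qed.

Lemma eq_cfgE (s t : cfg X) : [forall x, s x == t x] = (s == t).
Proof.
by apply/forallP/eqP => [h|-> //]; apply/ffunP => x; apply/eqP.
Qed.

Lemma pstr0 : P [ffun=> 0] = @op1 R X.
Proof.
apply: opP => s t; rewrite /pstr /op1 -eq_cfgE -prod_natb.
by apply: eq_bigr => x _; rewrite ffunE.
Qed.

Lemma pstr_xorK f g : pstr_xor (pstr_xor f g) g = f.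
Proof. by apply/ffunP => x; rewrite !ffunE pauli_xorK. Qed.

Lemma pstr_xorff f : pstr_xor f f = [ffun=> 0].
Proof. by apply/ffunP => x; rewrite !ffunE; apply/eqP; rewrite pauli_xor_eq0. Qed.

Lemma pstrK f : P f *o P f = @op1 R X.
Proof.
rewrite pstrM pstr_xorff pstr0 /pstr_phase big1 ?opscale1 // => x _; exact: pauli_phase_id.
Qed.

(** Transposition fixes I, X, Z and negates Y, so the sign is the parity of the number of Y
    factors. *)
Definition tr_sign f : C := \prod_x (-1) ^+ (f x == 2 :> nat).

Lemma tr_sign_neq0 f : tr_sign f != 0.
Proof. by apply/prodf_neq0 => x _; rewrite signr_eq0. Qed.

Lemma pstr_tr f s t : P f t s = tr_sign f * P f s t.
Proof. by rewrite /pstr /tr_sign -big_split; apply: eq_bigr => x _; rewrite pauli1T. Qed.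

Lemma optr_pstr f : f != [ffun=> 0] -> optr (P f) = 0.
Proof.
move=> h; rewrite /optr /pstr (sum_cfg_prod (fun x b => pauli1 R (f x) b b)).
have [x hx] : exists x, f x != 0.
  apply/existsP; rewrite -negb_forall; apply: contra h => /forallP h.
  by apply/eqP/ffunP => x; rewrite ffunE; apply/eqP.
rewrite (bigD1 x) //= big_bool /pauli1.
by case: (f x) hx => [[|[|[|[|//]]]] ?] //= _; rewrite ?addr0 ?addNr mul0r.
Qed.

Lemma optr_pstrM f g : f != g -> optr (P f *o P g) = 0.
Proof.
move=> h; rewrite pstrM optrZ optr_pstr ?mulr0 //.
apply: contra h => /eqP h; apply/eqP/ffunP => x.
by apply/eqP; rewrite -pauli_xor_eq0; move/ffunP/(_ x): h; rewrite !ffunE => ->.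
Qed.

Lemma pstr_compl (u v s t : cfg X) :
  \sum_f P f u v * P f s t = 2 ^+ #|X| * ((v == s) && (u == t))%:R.
Proof.
transitivity (\sum_(f : {ffun X -> 'I_4}) \prod_x (pauli1 R (f x) (u x) (v x) * pauli1 R (f x) (s x) (t x))).
  by apply: eq_bigr => f _; rewrite -big_split.
rewrite (sum_cfg_prod (fun x a => pauli1 R a (u x) (v x) * pauli1 R a (s x) (t x))).
under eq_bigr do rewrite pauli1_compl -mulnb natrM.
rewrite big_split /= prodr_const -!eq_cfgE -mulnb natrM -!prod_natb.
by rewrite -big_split.
Qed.

(** Writing the coefficients as double sums over entries and summing over [f] first, [pstr_compl]
    leaves only the entry [M s t], multiplied by the dimension. *)
Lemma pauli_expansion (M : op R X) :
  M = opscale (2 ^- #|X|) (fun s t => \sum_f optr (P f *o M) * P f s t).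
Proof.
apply: opP => s t; rewrite /opscale.
under eq_bigr do rewrite /optr /opmul big_distrl /=.
rewrite exchange_big /= (bigD1 t) //= [X in _ + X]big1; last first.
  move=> u ut; under eq_bigr do rewrite big_distrl /=.
  rewrite exchange_big big1 //= => v _.
  under eq_bigr do rewrite mulrAC; rewrite -big_distrl /= pstr_compl.
  by rewrite (negbTE ut) andbF mulr0 mul0r.
under eq_bigr do rewrite big_distrl /=.
rewrite exchange_big /= (bigD1 s) //= [X in _ + X + _]big1; last first.
  move=> v vs; under eq_bigr do rewrite mulrAC; rewrite -big_distrl /= pstr_compl.
  by rewrite (negbTE vs) mulr0 mul0r.
under eq_bigr do rewrite mulrAC; rewrite -big_distrl /= pstr_compl !eqxx mulr1 !addr0.
by rewrite mulrA mulVf ?mul1r // expf_neq0 // pnatr_eq0.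
Qed.

End X.
End Pauli.

(** * Gates and measurements *)

Section Embed.
Variable R : realType.
Local Notation C := (complex R).
Variables (P : finType) (i j : P).
Hypothesis ij : i != j.
Implicit Types (U V : op R 'I_2) (s t : cfg P) (f g : {ffun P -> 'I_4}).

(** This is literally the argument that [embed2] hands to the two-qubit gate, with [ord0] standing
    for [i] and the other index for [j]; the two can thus be interchanged by conversion. *)
Definition pair_restr (T : Type) (s : {ffun P -> T}) : {ffun 'I_2 -> T} :=
  [ffun k => s (if k == ord0 then i else j)].
Definition pair_upd (T : Type) (s : {ffun P -> T}) (v : {ffun 'I_2 -> T}) : {ffun P -> T} :=
  [ffun x => if x == i then v ord0 else if x == j then v ord_max else s x].
Local Notation off x := ((x != i) && (x != j)).

Lemma ord2P (k : 'I_2) : k = ord0 \/ k = ord_max.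
Proof. by case: k => [[|[|//]] h]; [left|right]; apply/val_inj. Qed.

Lemma pair_updK (T : Type) (s : {ffun P -> T}) v : pair_restr (pair_upd s v) = v.
Proof.
apply/ffunP => k; rewrite !ffunE.
case: (ord2P k) => -> /=; first by rewrite eqxx.
by rewrite eq_sym (negbTE ij) eqxx.
Qed.

Lemma pair_upd_off (T : Type) (s : {ffun P -> T}) v x : off x -> pair_upd s v x = s x.
Proof. by move=> /andP [/negbTE h1 /negbTE h2]; rewrite ffunE h1 h2. Qed.

(** A configuration that agrees with [s] off the pair is determined by its two values on the
    pair. *)
Lemma sum_off (G : cfg P -> C) s :
  \sum_(u : cfg P | [forall k, off k ==> (s k == u k)]) G u = \sum_v G (pair_upd s v).
Proof.
rewrite (reindex_onto (pair_upd s) (@pair_restr bool)) /=.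
  apply: eq_bigl => v; rewrite pair_updK eqxx andbT.
  by apply/forallP => k; apply/implyP => h; rewrite pair_upd_off.
move=> u /forallP h; apply/ffunP => x; rewrite !ffunE.
case: eqVneq => [->|xi]; first by [].
case: eqVneq => [->|xj]; first by [].
by have := h x; rewrite xi xj => /eqP.
Qed.

Lemma embed2_opmul U (A : op R P) s t :
  (embed2 i j U *o A) s t = \sum_v U (pair_restr s) v * A (pair_upd s v) t.
Proof.
transitivity (\sum_(u : cfg P | [forall k, off k ==> (s k == u k)]) U (pair_restr s) (pair_restr u) * A u t).
  by rewrite big_mkcond; apply: eq_bigr => u _; rewrite /embed2; case: ifP => // _; rewrite mul0r.
by rewrite sum_off; apply: eq_bigr => v _; rewrite pair_updK.
Qed.

Lemma opmul_embed2 U (A : op R P) s t :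
  (A *o embed2 i j U) s t = \sum_v A s (pair_upd t v) * U v (pair_restr t).
Proof.
transitivity (\sum_(u : cfg P | [forall k, off k ==> (t k == u k)]) A s u * U (pair_restr u) (pair_restr t)).
  rewrite big_mkcond; apply: eq_bigr => u _; rewrite /embed2.
  have -> : [forall k, off k ==> (u k == t k)] = [forall k, off k ==> (t k == u k)].
    by apply: eq_forallb => k; rewrite [X in _ ==> X]eq_sym.
  by case: ifP => // _; rewrite mulr0.
by rewrite sum_off; apply: eq_bigr => v _; rewrite pair_updK.
Qed.

(** Together with [embed2_1] and [embed2_adj] this makes the embedding a homomorphism that respects
    adjoints, so that it preserves unitarity. *)
Lemma embed2M U V : embed2 i j U *o embed2 i j V = embed2 i j (U *o V).
Proof.
apply: opP => s t; rewrite embed2_opmul {2}/embed2.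
case: ifP => h.
  apply: eq_bigr => v _; rewrite /embed2 -[X in V X]/(pair_restr _) pair_updK ifT //.
  apply/forallP => k; apply/implyP => hk; rewrite pair_upd_off //.
  by move/forallP/(_ k): h; rewrite hk.
apply: big1 => v _; rewrite /embed2 ifF ?mulr0 //; apply/negbTE; move/negbT: h.
apply: contra => /forallP h; apply/forallP => k; apply/implyP => hk.
by have := h k; rewrite hk pair_upd_off.
Qed.

Lemma embed2_1 : embed2 i j (@op1 R 'I_2) = @op1 R P.
Proof.
apply: opP => s t; rewrite /embed2 /op1; case: ifP => [/forallP h|].
  congr (_%:R); congr nat_of_bool; apply/eqP/eqP => [/ffunP e|-> //].
  apply/ffunP => x; case: (eqVneq x i) => [->|xi].
    by have := e ord0; rewrite !ffunE.
  case: (eqVneq x j) => [->|xj]; first by have := e ord_max; rewrite !ffunE.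
  by have := h x; rewrite xi xj => /eqP.
move=> /negbT; rewrite negb_forall => /existsP [k].
by rewrite negb_imply => /andP [_ h]; case: eqVneq => // e; rewrite e eqxx in h.
Qed.

Lemma embed2_adj U : opadj (embed2 i j U) = embed2 i j (opadj U).
Proof.
apply: opP => s t; rewrite /opadj /embed2.
have -> : [forall k, off k ==> (t k == s k)] = [forall k, off k ==> (s k == t k)].
  by apply: eq_forallb => k; rewrite [X in _ ==> X]eq_sym.
by case: ifP => // _; rewrite conjc0.
Qed.

Lemma embed2_unitary U : unitary U -> embed2 i j U *o opadj (embed2 i j U) = @op1 R P.
Proof. by move=> h; rewrite embed2_adj embed2M h embed2_1. Qed.

Definition offprod f s t : C := \prod_(k | off k) pauli1 R (f k) (s k) (t k).

Lemma pstr_split f s t :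
  pstr R f s t = offprod f s t * pstr R (pair_restr f) (pair_restr s) (pair_restr t).
Proof.
rewrite /pstr /offprod big_ord_recl big_ord1 !ffunE /= (bigD1 i) //= (bigD1 j) 1?eq_sym //=.
by rewrite mulrA mulrC.
Qed.

Lemma offprod_updl f s t v : offprod f (pair_upd s v) t = offprod f s t.
Proof. by apply: eq_bigr => k h; rewrite pair_upd_off. Qed.
Lemma offprod_updr f s t v : offprod f s (pair_upd t v) = offprod f s t.
Proof. by apply: eq_bigr => k h; rewrite pair_upd_off. Qed.

(** A string factors into its part on the pair and its part off the pair. The embedded gate leaves
    the second factor alone, so a commutation rule on the pair lifts to all of [P]. *)
Lemma embed2_pstr U f (g : {ffun 'I_2 -> 'I_4}) (k : C) :
  U *o pstr R (pair_restr f) = opscale k (pstr R g *o U) ->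
  embed2 i j U *o pstr R f = opscale k (pstr R (pair_upd f g) *o embed2 i j U).
Proof.
move=> h; apply: opP => s t; rewrite embed2_opmul /opscale opmul_embed2.
transitivity (offprod f s t * (U *o pstr R (pair_restr f)) (pair_restr s) (pair_restr t)).
  rewrite /opmul big_distrr; apply: eq_bigr => v _ /=.
  by rewrite pstr_split pair_updK offprod_updl mulrCA.
rewrite h /opscale /opmul mulrCA; congr (_ * _); rewrite big_distrr; apply: eq_bigr => v _ /=.
rewrite pstr_split !pair_updK offprod_updr mulrA; congr (_ * _ * _).
by apply: eq_bigr => x hx; rewrite pair_upd_off.
Qed.

(** The conjugation rule multiplied by [U] on the right becomes an intertwining rule, since [U] is
    also a left inverse of its own adjoint up to order. Only the nonvanishing of the phase is
    recorded. *)
Lemma clifford_embed2 U f : clifford2 U ->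
  exists g (k : C), k != 0 /\ embed2 i j U *o pstr R f = opscale k (pstr R g *o embed2 i j U).
Proof.
move=> [hu hc]; have [g [k h]] := hc (pair_restr f).
exists (pair_upd f g), ((Complex 0 1) ^+ k); split.
  by rewrite expf_neq0 // eq_complex /= oner_eq0 andbF.
apply: embed2_pstr; rewrite -opmulZl -h -!opmulA.
by rewrite (opmul1C hu) opmul1.
Qed.

End Embed.

(** * Projective single-qubit Z measurements *)

Section Meas.
Variable R : realType.
Local Notation C := (complex R).
Variables (P : finType) (i : P).
Implicit Types (f g : {ffun P -> 'I_4}) (b : bool).
Local Notation Z := (@zproj R P i).

Lemma zproj_opmul b (A : op R P) s t : (Z b *o A) s t = (s i == b)%:R * A s t.
Proof.
rewrite /opmul (bigD1 s) //= [X in _ + X]big1 ?addr0; first by rewrite /zproj eqxx.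
by move=> u; rewrite eq_sym /zproj => /negbTE ->; rewrite mul0r.
Qed.

Lemma opmul_zproj b (A : op R P) s t : (A *o Z b) s t = (t i == b)%:R * A s t.
Proof.
rewrite /opmul (bigD1 t) //= [X in _ + X]big1 ?addr0; first by rewrite /zproj eqxx mulrC.
by move=> u; rewrite /zproj => /negbTE ->; rewrite mulr0.
Qed.

Lemma zproj_adj b : opadj (Z b) = Z b.
Proof.
apply: opP => s t; rewrite /opadj /zproj rmorph_nat eq_sym.
by case: eqVneq => // ->.
Qed.

Definition zdiag (a : 'I_4) := (a == 0) || (a == 3 :> nat).
Definition set_at f (a : 'I_4) : {ffun P -> 'I_4} := [ffun x => if x == i then a else f x].

Lemma pstr_at f s t :
  pstr R f s t = pauli1 R (f i) (s i) (t i) * \prod_(x | x != i) pauli1 R (f x) (s x) (t x).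
Proof. by rewrite /pstr (bigD1 i). Qed.

(** X and Y flip the bit at [i], whereas both projectors force it to be [b]. *)
Lemma zproj_pstr_offdiag f b : ~~ zdiag (f i) -> Z b *o pstr R f *o Z b = fun _ _ => 0.
Proof.
move=> h; apply: opP => s t; rewrite opmul_zproj zproj_opmul pstr_at /pauli1.
case: (f i) h => [[|[|[|[|//]]]] ?] //= _; case: (s i); case: (t i); case: b => /=;
  by rewrite ?(mul0r, mulr0).
Qed.

(* On the range of [Z b] the operators [Z_i] and [(-1)^b] coincide. *)
Lemma pstr_zproj_set f a b : zdiag (f i) -> zdiag a ->
  pstr R (set_at f a) *o Z b = opscale ((-1) ^+ (b && (f i != a))) (Z b *o pstr R f).
Proof.
move=> hf ha; apply: opP => s t; rewrite opmul_zproj /opscale zproj_opmul !pstr_at /set_at ffunE eqxx.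
under eq_bigr => x hx do rewrite ffunE (negbTE hx).
rewrite !mulrA; congr (_ * _); rewrite /pauli1 -(inj_eq val_inj).
case: (f i) hf => [[|[|[|[|//]]]] ?] //= _; case: a ha => [[|[|[|[|//]]]] ?] //= _;
by case: (s i); case: (t i); case: b; rewrite /= ?expr0 ?expr1 ?(mul0r,mulr0,mul1r,mulr1,mulN1r,opprK,oppr0).
Qed.

(** A diagonal factor commutes with the projector, which is idempotent and equals (1 + (-1)^b
    Z_i)/2. Expanding it leaves the strings with I and with Z at site [i]. *)
Lemma zproj_pstr_zproj f b : zdiag (f i) ->
  Z b *o pstr R f *o Z b =
  (fun s t => 2^-1 * (((-1) ^+ (b && (f i != 0))) * pstr R (set_at f 0) s t
     + ((-1) ^+ (b && (f i == 0))) * pstr R (set_at f (inZp 3)) s t)).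
Proof.
have two : (1 + 1 : C) = 2 by [].
move=> h; apply: opP => s t; rewrite opmul_zproj zproj_opmul !pstr_at /set_at !ffunE eqxx.
set p := \prod_(x | _) _.
under eq_bigr => x hx do rewrite ffunE (negbTE hx).
under [in X in _ = _ * (_ + X)]eq_bigr => x hx do rewrite ffunE (negbTE hx).
rewrite -/p !mulrA -mulrDl mulrA; congr (_ * _); rewrite /pauli1.
case: (f i) h => [[|[|[|[|//]]]] ?] //= _;
by case: (s i); case: (t i); case: b; rewrite /= ?expr0 ?expr1 ?(mul0r,mulr0,mul1r,mulr1,mulN1r,opprK,oppr0,addr0,subrr,addNr) // ?two ?mulVf ?pnatr_eq0 // -opprD two mulrN mulVf ?pnatr_eq0.
Qed.

End Meas.

(** * Stabilizers of monitored circuits *)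

Section Circuit.
Variable R : realType.
Local Notation C := (complex R).

(** The same extension by [false] as inside [Cm]. Records as functions on all naturals do not depend
    on the number of measurements, which suits induction on the circuit. *)
Definition outcome_fun n (m : {ffun 'I_n -> bool}) (k : nat) : bool :=
  if (insub k : option 'I_n) is Some i then m i else false.
Definition outcome_cons (b : bool) (m : nat -> bool) (k : nat) : bool :=
  if k is k'.+1 then m k' else b.
Definition parity_sign n (a m : nat -> bool) : C := \prod_(j < n) (-1) ^+ (a j && m j).

Lemma outcome_fun_ord n (m : {ffun 'I_n -> bool}) (j : 'I_n) : outcome_fun m j = m j.
Proof. by rewrite /outcome_fun insubT //= => h; congr (m _); apply/val_inj. Qed.

Lemma parity_sign_sqr n a m : parity_sign n a m * parity_sign n a m = 1.
Proof. by rewrite /parity_sign -big_split big1 //= => j _; rewrite -expr2 sqrr_sign. Qed.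

Lemma parity_sign_neq0 n a m : parity_sign n a m != 0.
Proof. by apply/eqP => h; have := parity_sign_sqr n a m; rewrite h mul0r => /eqP; rewrite eq_sym oner_eq0. Qed.

Lemma parity_signS n b a m : parity_sign n.+1 (outcome_cons b a) m = (-1) ^+ (b && m 0%N) * parity_sign n a (fun j => m j.+1).
Proof. by rewrite /parity_sign big_ord_recl. Qed.

(** Splits off the earliest outcome, matching the way a leading measurement consumes outcome 0. *)
Lemma sum_outcomesS n (F : (nat -> bool) -> C) :
  \sum_(m : {ffun 'I_n.+1 -> bool}) F (outcome_fun m) =
  \sum_(b : bool) \sum_(m : {ffun 'I_n -> bool}) F (outcome_cons b (outcome_fun m)).
Proof.
rewrite pair_big /=.
pose h (p : bool * {ffun 'I_n -> bool}) : {ffun 'I_n.+1 -> bool} :=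
  [ffun k => if unlift ord0 k is Some j then p.2 j else p.1].
have bh : bijective h.
  exists (fun m : {ffun 'I_n.+1 -> bool} => (m ord0, [ffun j => m (lift ord0 j)])).
    move=> [b m]; rewrite /h ffunE unlift_none; congr pair.
    by apply/ffunP => j; rewrite !ffunE liftK.
  move=> m; apply/ffunP => k; rewrite !ffunE /=.
  by case: unliftP => [j ->|->] //; rewrite ffunE.
rewrite (reindex h) /=; last exact: onW_bij.
apply: eq_bigr => -[b m] _; congr F; apply/funext => k /=.
case: k => [|k] /=; first by rewrite -[0%N]/(val (@ord0 n)) outcome_fun_ord ffunE unlift_none.
case: (ltnP k n) => kn.
  have -> : k.+1 = lift ord0 (Ordinal kn) :> nat by [].
  rewrite outcome_fun_ord ffunE liftK /=.
  exact: esym (outcome_fun_ord _ (Ordinal kn)).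
(* Beyond the last measurement both extended records take the default [false]. *)
by rewrite /outcome_fun !insubF // ltnNge ?ltnS kn.
Qed.

Lemma opmul_sumr (X I : finType) (A : op R X) (F : I -> op R X) :
  A *o (fun s t => \sum_k F k s t) = fun s t => \sum_k (A *o F k) s t.
Proof.
apply: opP => s t; rewrite /opmul; under eq_bigr do rewrite big_distrr /=.
exact: exchange_big.
Qed.

Lemma opmul_suml (X I : finType) (A : op R X) (F : I -> op R X) :
  (fun s t => \sum_k F k s t) *o A = fun s t => \sum_k (F k *o A) s t.
Proof.
apply: opP => s t; rewrite /opmul; under eq_bigr do rewrite big_distrl /=.
exact: exchange_big.
Qed.

Lemma optr_lin2 (X : finType) (A B D : op R X) z x y :
  optr (A *o (fun s t => z * (x * B s t + y * D s t))) =
  z * (x * optr (A *o B) + y * optr (A *o D)).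
Proof.
rewrite /optr /opmul !big_distrr -big_split big_distrr; apply: eq_bigr => s _ /=.
rewrite !big_distrr -big_split big_distrr; apply: eq_bigr => t _ /=.
by ring.
Qed.

Variable P : finType.
Implicit Types (c : seq (step R P)).

(** Trades the starting index of the outcome counter for a shift of the record, so that induction
    hypotheses are only needed at index 0. *)
Lemma circ_op_shift c k l m : circ_op c (k + l) m = circ_op c k (fun j => m (j + l)%N).
Proof.
elim: c k => //= -[i j U|i] c ih k; first by rewrite ih.
by rewrite -addSn ih.
Qed.

Lemma circ_op_meas i c m :
  circ_op (Meas R i :: c) 0 m = circ_op c 0 (fun j => m j.+1) *o @zproj R P i (m 0%N).
Proof.
rewrite /= -[1%N]/(0 + 1)%N circ_op_shift; congr (circ_op _ _ _ *o _).
by apply/funext => j; rewrite addn1.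
Qed.

(* The Choi state of [circ_op c 0 m] is a stabilizer state, and up to signs that are linear
   in the outcomes its stabilizer group is the same for all outcome records. *)
Lemma circ_stabilizer c : valid_circuit c -> forall (g f : {ffun P -> 'I_4}) m,
  optr (opadj (circ_op c 0 m) *o pstr R g *o circ_op c 0 m *o pstr R f) = 0 \/
  exists (a : nat -> bool) (e : C), forall m',
    opscale (parity_sign (nmeas c) a m') (pstr R g *o circ_op c 0 m') =
    opscale e (circ_op c 0 m' *o pstr R f).
Proof.
elim: c => [|[i j U|i] c ih] /=.
- move=> _ g f m; rewrite opadj1 op1mul opmul1.
  case: (eqVneq g f) => [->|gf]; last by left; apply: optr_pstrM.
  right; exists (fun=> false), 1 => m'.
  by rewrite /parity_sign big_ord0 op1mul.
- move=> [[ij cU] vc] g f m.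
  (* Moving [f] through the gate turns it into [f'] up to the factor [k]; the induction hypothesis
     at [f'] then settles both alternatives. *)
  have [f' [k [k0 hk]]] := clifford_embed2 ij f cU.
  set E := embed2 i j U in hk *.
  have uE : E *o opadj E = @op1 R P by apply: embed2_unitary => //; case: cU.
  case: (ih vc g f' m) => [h|[a [e h]]]; [left|right].
    rewrite opadjM -!opmulA hk !opmulZr optrZ optrC -!opmulA uE opmul1.
    by rewrite !opmulA h mulr0.
  exists a, (e / k) => m'; rewrite opmulA -opmulZl h opmulZl -!opmulA hk opmulZr opscaleA.
  by rewrite mulfVK.
- move=> [_ vc] g f m; rewrite -[circ_op c 1 m *o _]/(circ_op (Meas R i :: c) 0 m).
  (* On the range of the projector, site [i] of [f] may be replaced by I or Z at the cost of a sign;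
     a stabilizer for either replacement gives one for [f]. *)
  have main a : zdiag (f i) -> zdiag a ->
      optr (opadj (circ_op c 0 (fun j => m j.+1)) *o pstr R g *o circ_op c 0 (fun j => m j.+1)
        *o pstr R (set_at i f a)) = 0 \/
      exists (a : nat -> bool) (e : C), forall m',
      opscale (parity_sign (nmeas c).+1 a m') (pstr R g *o circ_op (Meas R i :: c) 0 m') =
      opscale e (circ_op (Meas R i :: c) 0 m' *o pstr R f).
    move=> hf ha; case: (ih vc g (set_at i f a) (fun j => m j.+1)) => [h|[w [e h]]]; [by left|right].
    (* The new outcome enters the sign exactly when the replacement changes the factor at site
       [i]. *)
    exists (outcome_cons (f i != a) w), e => m'.
    rewrite circ_op_meas parity_signS -opscaleA opmulA -opmulZl h opmulZl -opmulA pstr_zproj_set //.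
    rewrite opmulZr !opscaleA -mulrA [e * _]mulrC mulrA [m' 0%N && _]andbC -expr2 sqrr_sign mul1r.
    by rewrite !opmulA.
  rewrite circ_op_meas opadjM zproj_adj.
  have -> (A B D Z : op R P) : optr (Z *o A *o B *o (D *o Z) *o pstr R f) =
      optr (A *o B *o D *o (Z *o pstr R f *o Z)).
    by rewrite -!opmulA optrC -!opmulA.
  case: (boolP (zdiag (f i))) => hf; last first.
    left; rewrite zproj_pstr_offdiag // /optr big1 // => s _.
    by rewrite /opmul big1 // => u _; rewrite mulr0.
  (* The trace is a combination of the traces for the two replacements I and Z, so it vanishes if
     both of these do. *)
  rewrite zproj_pstr_zproj // optr_lin2.
  case: (main 0 hf isT) => [->|h]; last by right.
  case: (main (inZp 3) hf isT) => [->|h]; last by right.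
  by left; rewrite !mulr0 addr0 mulr0.
Qed.

(** Completeness of the Kraus operators: gates cancel by unitarity, and the two projectors of each
    measurement sum to the identity. *)
Lemma circ_isometry c : valid_circuit c ->
  (fun s t => \sum_(m : {ffun 'I_(nmeas c) -> bool})
     (opadj (circ_op c 0 (outcome_fun m)) *o circ_op c 0 (outcome_fun m)) s t) = @op1 R P.
Proof.
elim: c => [|[i j U|i] c ih] /=; [move=> _|move=> [[ij cU] vc]|move=> [_ vc]].
- apply: opP => s t; rewrite /= opadj1 op1mul.
  (* Without measurements there is exactly one record, the empty one. *)
  rewrite sumr_const card_ffun card_ord expn0 //.
-
  set E := embed2 i j U.
  have uE : opadj E *o E = @op1 R P.
    by apply: opmul1C; apply: embed2_unitary => //; case: cU.
  rewrite -uE -[X in _ = _ *o X]op1mul -(ih vc) opmul_suml opmul_sumr.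
  apply: opP => s t; apply: eq_bigr => m _.
  by rewrite opadjM !opmulA.
- apply: opP => s t.
  rewrite (sum_outcomesS _ (fun m => (opadj (circ_op (Meas R i :: c) 0 m) *o circ_op (Meas R i :: c) 0 m) s t)).
  have e b m : (opadj (circ_op (Meas R i :: c) 0 (outcome_cons b m)) *o circ_op (Meas R i :: c) 0 (outcome_cons b m)) s t =
     ((t i == b)%:R * (s i == b)%:R) * (opadj (circ_op c 0 m) *o circ_op c 0 m) s t.
    by rewrite circ_op_meas opadjM zproj_adj opmulA opmul_zproj -opmulA zproj_opmul mulrA.
  under eq_bigr do under eq_bigr do rewrite e.
  under eq_bigr do rewrite -big_distrr /=.
  have /(congr1 (fun A : op R P => A s t)) /= -> := ih vc.
  rewrite -big_distrl /= big_bool /op1.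
  case: (eqVneq s t) => [->|]; last by rewrite mulr0.
  by case: (t i); rewrite /= ?(mul0r,mulr0,mul1r,mulr1,add0r,addr0).
Qed.

End Circuit.

(** * The adjoint channel *)

Section Sums.
Variables (X Y : finType).

Definition ffun_inl T (f : {ffun (X + Y)%type -> T}) : {ffun X -> T} := [ffun x => f (inl x)].
Definition ffun_inr T (f : {ffun (X + Y)%type -> T}) : {ffun Y -> T} := [ffun y => f (inr y)].
Definition ffun_join T (f : {ffun X -> T}) (g : {ffun Y -> T}) : {ffun (X + Y)%type -> T} :=
  [ffun z => match z with inl x => f x | inr y => g y end].

Lemma ffun_joinl T (f : {ffun X -> T}) g : ffun_inl (ffun_join f g) = f.
Proof. by apply/ffunP => x; rewrite !ffunE. Qed.
Lemma ffun_joinr T (f : {ffun X -> T}) g : ffun_inr (ffun_join f g) = g.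
Proof. by apply/ffunP => x; rewrite !ffunE. Qed.
Lemma ffun_joinK T (f : {ffun (X + Y)%type -> T}) : ffun_join (ffun_inl f) (ffun_inr f) = f.
Proof. by apply/ffunP => -[x|x]; rewrite !ffunE. Qed.

Variable R : realType.
Local Notation C := (complex R).

Lemma sum_ffun_join (J : finType) (F : {ffun (X + Y)%type -> J} -> C) :
  \sum_f F f = \sum_f \sum_g F (ffun_join f g).
Proof.
rewrite pair_big /= (reindex (fun p => ffun_join p.1 p.2)) //=.
apply: onW_bij; exists (fun f => (ffun_inl f, ffun_inr f)) => [[f g]|f] /=.
  by rewrite ffun_joinl ffun_joinr.
exact: ffun_joinK.
Qed.

Lemma pstr_join f (s t : cfg (X + Y)%type) :
  pstr R f s t = pstr R (ffun_inl f) (lpart s) (lpart t) * pstr R (ffun_inr f) (rpart s) (rpart t).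
Proof.
rewrite /pstr big_sumType /=.
by congr (_ * _); apply: eq_bigr => x _; rewrite !ffunE.
Qed.

Lemma psupport_sum f (A : {set X}) (B : {set Y}) :
  (psupport f \subset [set inl a | a in A] :|: [set inr b | b in B]) =
  (psupport (ffun_inl f) \subset A) && (psupport (ffun_inr f) \subset B).
Proof.
have eA x : ((inl x : X + Y) \in [set inl a | a in A] :|: [set inr b | b in B]) = (x \in A).
  rewrite inE mem_imset; last by move=> ? ? [].
  by rewrite orbC; case: imsetP => // -[].
have eB x : ((inr x : X + Y) \in [set inl a | a in A] :|: [set inr b | b in B]) = (x \in B).
  rewrite inE [X in _ || X]mem_imset; last by move=> ? ? [].
  by case: imsetP => // -[].
apply/fintype.subsetP/andP => [h|[/fintype.subsetP hA /fintype.subsetP hB] [x|x]].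
- by split; apply/fintype.subsetP => x; rewrite inE ffunE => hx; rewrite -?eA -?eB h // inE.
- by rewrite eA inE => hx; apply: hA; rewrite inE ffunE.
- by rewrite eB inE => hx; apply: hB; rewrite inE ffunE.
Qed.

End Sums.

(** * Pauli strings under the adjoint of the monitored channel *)

Section Channel.
Variable R : realType.
Local Notation C := (complex R).
Variables (P : finType) (c : seq (step R P)).
Local Notation out := {ffun 'I_(nmeas c) -> bool}.
Implicit Types m : out.

Lemma CmE m : Cm m = circ_op c 0 (outcome_fun m).
Proof. by []. Qed.

Lemma opmul_unit (A B : op R P) s t u v :
  (A *o unit_op R s t *o B) u v = A u s * B t v.
Proof.
rewrite /opmul (bigD1 t) //= [X in _ + X]big1 ?addr0.
  rewrite (bigD1 s) //= [X in _ + X]big1 ?addr0; last first.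
    by move=> x /negbTE h; rewrite /unit_op h mulr0.
  by rewrite /unit_op !eqxx mulr1.
move=> x /negbTE h; rewrite big1 ?mul0r // => y _.
by rewrite /unit_op h andbF mulr0.
Qed.

Lemma chanC_unit s t (a a' : cfg P) (b b' : out) :
  @chanC R P c (unit_op R s t) (ffun_join a b) (ffun_join a' b') =
  (b == b')%:R * (Cm b a s * conjc (Cm b a' t)).
Proof.
rewrite /chanC (bigD1 b) //= [X in _ + X]big1 ?addr0; last first.
  move=> m mb; rewrite /tens /unit_op.
  by rewrite -[rpart _]/(ffun_inr (ffun_join a b)) ffun_joinr [b == m]eq_sym (negbTE mb) mulr0.
rewrite /tens /unit_op.
rewrite -![lpart _]/(ffun_inl _) -![rpart _]/(ffun_inr _) !ffun_joinl !ffun_joinr eqxx /= opmul_unit.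
by rewrite mulrC eq_sym.
Qed.

(** The channel output is block diagonal in the register, so the adjoint sees only the diagonal
    entries of the register string, which weight the terms C_m^dagger g C_m. *)
Lemma hadj_chanC x g :
  hadj (@chanC R P c) (opscale x (pstr R g)) =
  opscale x (fun s t => \sum_m pstr R (ffun_inr g) m m *
     (opadj (Cm m) *o pstr R (ffun_inl g) *o Cm m) s t).
Proof.
apply: opP => s t; rewrite /hadj /optr [in LHS]/opmul sum_ffun_join exchange_big /opscale big_distrr.
apply: eq_bigr => b _ /=.
have e (a a' : cfg P) (b' : out) :
    opadj (@chanC R P c (unit_op R s t)) (ffun_join a b) (ffun_join a' b') * (x * pstr R g (ffun_join a' b') (ffun_join a b))
   = (b' == b)%:R * (x * (pstr R (ffun_inr g) b b * (conjc (Cm b a' s) * pstr R (ffun_inl g) a' a * Cm b a t))).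
  rewrite /opadj chanC_unit; case: (eqVneq b' b) => [->|]; last by rewrite !mul0r conjc0 mul0r.
  rewrite !mul1r rmorphM /= conjcK pstr_join.
  rewrite -![lpart _]/(ffun_inl _) -![rpart _]/(ffun_inr _) !ffun_joinl !ffun_joinr.
  by ring.
under eq_bigr do rewrite sum_ffun_join exchange_big /=.
under eq_bigr do under eq_bigr do under eq_bigr do rewrite e.
rewrite mulrA [in RHS]/opmul !big_distrr; apply: eq_bigr => a _ /=.
rewrite (bigD1 b) //= [X in _ + X]big1 ?addr0; last first.
  by move=> b' /negbTE ->; rewrite big1 // => a' _; rewrite mul0r.
rewrite big_distrl big_distrr; apply: eq_bigr => a' _ /=.
by rewrite eqxx mul1r mulrA.
Qed.

Lemma parity_sign_pstr (a : nat -> bool) m :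
  parity_sign R (nmeas c) a (outcome_fun m) = pstr R [ffun j : 'I_(nmeas c) => if a j then inZp 3 else 0] m m.
Proof.
apply: eq_bigr => j _; rewrite outcome_fun_ord ffunE.
by case: (a j); case: (m j).
Qed.

Lemma optr_sum (X I : finType) (F : I -> op R X) :
  optr (fun s t => \sum_k F k s t) = \sum_k optr (F k).
Proof. exact: exchange_big. Qed.

Lemma optr1 (X : finType) : optr (@op1 R X) != 0.
Proof.
rewrite /optr /op1; under eq_bigr do rewrite eqxx.
by rewrite sumr_const card_ffun card_bool pnatr_eq0 expn_eq0.
Qed.

Hypothesis vc : valid_circuit c.
Variable m0 : out.
Hypothesis Cm0 : optr (opadj (Cm m0) *o Cm m0) != 0.

(** Encoded as a nonvanishing overlap, which is boolean and can be counted; [stab_eigen] and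
    [eigen_stab] identify it with the commutation relation up to a nonzero scalar. *)
Definition stab (g f : {ffun P -> 'I_4}) : bool :=
  optr (opadj (Cm m0) *o pstr R g *o Cm m0 *o pstr R f) != 0.

(** Using the relation at [m0] twice, with Pauli strings and parity signs squaring to 1, gives
    [e * e] times [Cm m0] equal to [Cm m0]; the nonzero norm of [Cm m0] forces [e * e = 1]. *)
Lemma stabP g f : stab g f -> exists (a : nat -> bool) (e : C), e * e = 1 /\ forall m,
  opscale (parity_sign R (nmeas c) a (outcome_fun m)) (pstr R g *o Cm m) = opscale e (Cm m *o pstr R f).
Proof.
move=> /negP gf; case: (circ_stabilizer vc g f (outcome_fun m0)) => [|[a [e h]]].
  by rewrite -CmE => /eqP.
exists a, e; split; last by move=> m; rewrite CmE.
have {}h := h (outcome_fun m0); rewrite -CmE in h; move: (parity_sign R _ a _) (parity_sign_sqr R (nmeas c) a (outcome_fun m0)) h => w w2 h.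
have e2 : opscale (e * e) (Cm m0) = Cm m0.
  rewrite -[in LHS](opmul1 (Cm m0)) -(pstrK R f) opmulA -opscaleA -opmulZl -h.
  rewrite opmulZl -opmulA opscaleA mulrC -opscaleA -opmulZr -h opmulZr opscaleA w2 opscale1.
  by rewrite opmulA pstrK op1mul.
have /eqP := congr1 (fun K => optr (opadj (Cm m0) *o K)) e2.
by rewrite /= opmulZr optrZ -[X in _ == X]mul1r (inj_eq (mulIf Cm0)) => /eqP.
Qed.

(** Forward, a nonzero overlap at some record is transported to [m0] by the uniformity of
    [circ_stabilizer]. Backward, a Z-string on the register cancels the outcome-dependent signs. *)
Lemma hadj_stab (B : {set P}) f :
  (exists g : {ffun (P + 'I_(nmeas c))%type -> 'I_4},
     psupport g \subset [set inl b | b in B] :|: [set inr k | k in [set: 'I_(nmeas c)]] /\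
     exists sg : bool, pstr R f = hadj (@chanC R P c) (opscale ((-1) ^+ sg) (pstr R g))) <->
  exists h, (psupport h \subset B) && stab h f.
Proof.
split=> [[g [gB [sg h]]]|[h /andP [hB hf]]].
  exists (ffun_inl g); move: gB; rewrite psupport_sum => /andP [-> _] /=.
  rewrite hadj_chanC in h.
  (* Multiply the assumed equality by [f] and take traces: the string squares to the identity, whose
     trace is nonzero. *)
  have : \sum_m pstr R (ffun_inr g) m m *
      optr (opadj (Cm m) *o pstr R (ffun_inl g) *o Cm m *o pstr R f) != 0.
    have := optr1 P; rewrite -(pstrK R f) {1}h opmulZl optrZ mulf_eq0 signr_eq0 /=.
    rewrite opmul_suml optr_sum.
    have e m : optr ((fun s t => pstr R (ffun_inr g) m m * (opadj (Cm m) *o pstr R (ffun_inl g) *o Cm m) s t)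
        *o pstr R f) = pstr R (ffun_inr g) m m * optr (opadj (Cm m) *o pstr R (ffun_inl g) *o Cm m *o pstr R f).
      by rewrite -optrZ -opmulZl.
    by rewrite (eq_bigr _ (fun m _ => e m)).
  move=> /eqP sn0.
  have [m /eqP hm] : exists m, optr (opadj (Cm m) *o pstr R (ffun_inl g) *o Cm m *o pstr R f) <> 0.
    apply: contrapT => no; apply: sn0; apply: big1 => m _.
    case: (eqVneq (optr (opadj (Cm m) *o pstr R (ffun_inl g) *o Cm m *o pstr R f)) 0) => [->|/eqP hm].
      by rewrite mulr0.
    by case: no; exists m.
  case: (circ_stabilizer vc (ffun_inl g) f (outcome_fun m)) => [/eqP|[a [e he]]].
    by rewrite -CmE (negbTE hm).
  (* If [e] were zero, the relation at [m] would kill the overlap [hm]. *)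
  have e0 : e != 0.
    apply/eqP => e0; move: hm; have := he (outcome_fun m); rewrite -CmE e0 => hem.
    rewrite -[X in optr (X *o _)]opmulA.
    have := congr1 (opscale (parity_sign R (nmeas c) a (outcome_fun m))) hem.
    rewrite opscaleA parity_sign_sqr opscale1 => ->.
    by rewrite !(opmulZl, opmulZr) !optrZ mul0r mulr0 eqxx.
  have := he (outcome_fun m0); rewrite -CmE => hem.
  have {hem} := congr1 (opscale (parity_sign R (nmeas c) a (outcome_fun m0))) hem.
  rewrite opscaleA parity_sign_sqr opscale1 => hem.
  rewrite /stab -[X in optr (X *o _)]opmulA hem !(opmulZl, opmulZr) !optrZ -!opmulA pstrK opmul1.
  by rewrite !mulf_neq0 // parity_sign_neq0.
have [a [e [e2 he]]] := stabP hf.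
(* Z sits on the register qubits selected by [a], so its diagonal is the parity sign and squares it
   away. *)
exists (ffun_join h [ffun j : 'I_(nmeas c) => if a j then inZp 3 else 0]).
rewrite psupport_sum ffun_joinl ffun_joinr hB; split; first by apply/fintype.subsetP => x _; rewrite inE.
have [sg esg] : exists sg : bool, e = (-1) ^+ sg.
  have : (e - 1) * (e + 1) = 0 by rewrite -[0](subrr 1) -[X in _ = X - _]e2; ring.
  move=> /eqP; rewrite mulf_eq0 subr_eq0 addr_eq0 => /orP [] /eqP ->.
    by exists false.
  by exists true.
exists sg; rewrite hadj_chanC ffun_joinl ffun_joinr -esg.
have -> : (fun s t => \sum_(m : out) pstr R [ffun j : 'I_(nmeas c) => if a j then inZp 3 else 0] m m *
      (opadj (Cm m) *o pstr R h *o Cm m) s t) =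
   (fun s t => \sum_(m : out) (opscale e (opadj (Cm m) *o Cm m *o pstr R f)) s t).
  apply: opP => s t; apply: eq_bigr => m _; rewrite -parity_sign_pstr.
  rewrite -[LHS]/((opscale _ (opadj (Cm m) *o pstr R h *o Cm m)) s t).
  by rewrite -!opmulA -[in LHS]opmulZr he opmulZr.
have -> : (fun s t => \sum_(m : out) (opscale e (opadj (Cm m) *o Cm m *o pstr R f)) s t) =
    opscale e (pstr R f).
  rewrite -[in RHS](op1mul (pstr R f)) -(circ_isometry vc) opmul_suml.
  by apply: opP => s t; rewrite /opscale big_distrr.
by rewrite opscaleA e2 opscale1.
Qed.

End Channel.

(** * Entropy of stabilizer states *)

Section Spectrum.
Variable R : realType.
Local Notation C := (complex R).

Lemma char_poly_roots_sum n (A : 'M[C]_n) (rs : seq C) :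
  (0 < n)%N -> char_poly A = \prod_(z <- rs) ('X - z%:P) -> \sum_(z <- rs) z = \tr A.
Proof.
move=> n0 h; have sz : size rs = n.
  by have := size_char_poly A; rewrite h size_prod_XsubC => -[].
apply: oppr_inj; rewrite -char_poly_trace // h -coefPn_prod_XsubC sz //.
by rewrite -lt0n.
Qed.

(** Applying the quadratic relation to an eigenvector gives z^2 = l z. *)
Lemma flat_spectrum n (A : 'M[C]_n) (l : C) (rs : seq C) :
  A *m A = l *: A -> char_poly A = \prod_(z <- rs) ('X - z%:P) ->
  forall z, z \in rs -> z = 0 \/ z = l.
Proof.
move=> hA h z; rewrite -root_prod_XsubC -h -eigenvalue_root_char => /eigenvalueP [v hv v0].
have ez : v *m A *m A = z * z *: v by rewrite hv -scalemxAl hv scalerA.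
have /eqP : z * z *: v = l * z *: v by rewrite -ez -mulmxA hA -scalemxAr hv scalerA.
rewrite -subr_eq0 -scalerBl scaler_eq0 (negbTE v0) orbF -mulrBl mulf_eq0 subr_eq0.
by case/orP => /eqP; [right|left].
Qed.

(** Every eigenvalue is 0 or [r], so z log z = z log r for each root, and the roots sum to the trace
    1. No multiplicities have to be computed. *)
Lemma vN_entropy_flat (T : finType) (M : op R T) (r : R) :
  r != 0 -> M *o M = opscale (real_complex R r) M -> optr M = 1 ->
  vN_entropy M = - log2 r.
Proof.
move=> r0 hM tM.
have n0 : (0 < #|{: cfg T}|)%N by rewrite card_ffun card_bool expn_gt0.
have hA : mxop M *m mxop M = real_complex R r *: mxop M.
  by rewrite -mxopM hM; apply/matrixP => i j; rewrite !mxE.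
have val rs : char_poly (mxop M) = \prod_(z <- rs) ('X - z%:P) ->
    - \sum_(z <- rs) xlog2 (@complex.Re R z) = - log2 r.
  move=> h; congr (- _).
  have {1}-> : log2 r = @complex.Re R (\sum_(z <- rs) z) * log2 r.
    by rewrite (char_poly_roots_sum n0 h) mxtrace_mxop tM mul1r.
  rewrite (big_morph (@complex.Re R) (id1 := 0) (op1 := +%R)) //; last by move=> [? ?] [? ?].
  rewrite big_distrl /= !big_seq; apply: eq_bigr => z zr.
  case: (flat_spectrum hA h zr) => ->; rewrite /xlog2 /= ?eqxx ?mul0r //.
  by rewrite (negbTE r0).
rewrite /vN_entropy.
set S := (fun v : R => _).
(* Algebraic closedness supplies a list of roots, so [xget] does not fall back to its default
   value. *)
have ex : S (- log2 r).
  have [rs hrs] := closed_field_poly_normal (char_poly (mxop M)).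
  exists rs; rewrite {1}hrs (monicP (char_poly_monic _)) scale1r; split => //.
  by rewrite val // {1}hrs (monicP (char_poly_monic _)) scale1r.
have [rs [h ->]] := xgetPex 0 (ex_intro S _ ex).
exact: val.
Qed.

End Spectrum.

(** * Partial traces and reduced stabilizer states *)

Section Reduced.
Variable R : realType.
Local Notation C := (complex R).
Variables (Z : finType) (Y : {set Z}).
Local Notation SY := (Defs.subq Y).

Definition glue (T : Type) (a : {ffun SY -> T}) (s : {ffun Z -> T}) : {ffun Z -> T} :=
  [ffun z => if (insub z : option SY) is Some y then a y else s z].
Definition frestr (T : Type) (s : {ffun Z -> T}) : {ffun SY -> T} := [ffun y => s (val y)].

Lemma glue_in (T : Type) (a : {ffun SY -> T}) (s : {ffun Z -> T}) (y : SY) : glue a s (val y) = a y.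
Proof. by rewrite ffunE valK. Qed.

Lemma glue_out (T : Type) (a : {ffun SY -> T}) (s : {ffun Z -> T}) z : z \notin Y -> glue a s z = s z.
Proof. by move=> h; rewrite ffunE insubN. Qed.

Lemma frestr_glue (T : Type) (a : {ffun SY -> T}) (s : {ffun Z -> T}) : frestr (glue a s) = a.
Proof. by apply/ffunP => y; rewrite ffunE glue_in. Qed.

Lemma glue_ext (T : Type) (a : {ffun SY -> T}) (s t : {ffun Z -> T}) : frestr t = a ->
  (forall z, z \notin Y -> s z = t z) -> glue a s = t.
Proof.
move=> <- h; apply/ffunP => z; case: (boolP (z \in Y)) => hz; last by rewrite glue_out ?h.
by rewrite -[z]/(val (Sub z hz : SY)) glue_in ffunE.
Qed.

Lemma glue_glue (T : Type) (a b : {ffun SY -> T}) (s : {ffun Z -> T}) : glue a (glue b s) = glue a s.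
Proof. by apply: glue_ext => [|z hz]; rewrite ?frestr_glue // !glue_out. Qed.

Lemma glueK (T : Type) (s : {ffun Z -> T}) : glue (frestr s) s = s.
Proof. exact: glue_ext. Qed.

(** The inner sum has a single term: [t] is [b] on [Y] and agrees with [s] elsewhere. *)
Lemma ptraceE (rho : op R Z) a b :
  @ptrace R Z Y rho a b = \sum_(s | frestr s == a) rho s (glue b s).
Proof.
rewrite /ptrace [RHS]big_mkcond; apply: eq_bigr => s _.
rewrite -[restr Y s]/(frestr s); case: eqVneq => hs /=; last by rewrite big_pred0.
rewrite (big_pred1 (glue b s)) // => t /=; rewrite -[restr Y t]/(frestr t).
apply/andP/eqP => [[/eqP ht /forallP h]|->].
  by rewrite (glue_ext ht) // => z hz; have := h z; rewrite hz => /eqP.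
rewrite frestr_glue eqxx; split => //; apply/forallP => z; apply/implyP => hz.
by rewrite glue_out.
Qed.

Lemma optr_ptrace (rho : op R Z) : optr (@ptrace R Z Y rho) = optr rho.
Proof.
rewrite /optr [RHS](partition_big (@frestr bool) predT) //=.
apply: eq_bigr => a _; rewrite ptraceE; apply: eq_bigr => s /eqP <-.
by rewrite glueK.
Qed.

Definition pad (g : {ffun SY -> 'I_4}) : {ffun Z -> 'I_4} := glue g [ffun=> 0].

Lemma pstr_pad g s t : pstr R (pad g) s t =
  pstr R g (frestr s) (frestr t) * [forall z, (z \notin Y) ==> (s z == t z)]%:R.
Proof.
rewrite /pstr (bigID (mem Y)) /=; congr (_ * _).
  rewrite (reindex_omap (val : SY -> Z) insub) /=; last by move=> z hz; rewrite insubT.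
  apply: eq_big => [y|y _]; first by rewrite valK eqxx (valP y).
  by rewrite glue_in !ffunE.
rewrite -(@prod_natb R Z (fun z => (z \notin Y) ==> (s z == t z))) big_mkcond.
apply: eq_bigr => z _; case: (boolP (z \in Y)) => //= hz.
by rewrite glue_out // ffunE.
Qed.

Lemma pad_opmul g (rho : op R Z) s t :
  (pstr R (pad g) *o rho) s t = \sum_v pstr R g (frestr s) v * rho (glue v s) t.
Proof.
transitivity (\sum_(u : cfg Z | [forall z, (z \notin Y) ==> (s z == u z)])
    pstr R g (frestr s) (frestr u) * rho u t).
  rewrite big_mkcond; apply: eq_bigr => u _; rewrite pstr_pad.
  by case: ifP => _; rewrite ?mulr1 ?mulr0 ?mul0r.
rewrite (reindex_onto (fun v => glue v s) (@frestr bool)) /=; last first.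
  by move=> u /forallP h; apply: glue_ext => // z hz; have := h z; rewrite hz => /eqP.
apply: eq_big => [v|v _]; last by rewrite frestr_glue.
rewrite frestr_glue eqxx andbT; apply/forallP => z; apply/implyP => hz.
by rewrite glue_out.
Qed.

(** An operator acting only on the kept qubits commutes with tracing out the others. *)
Lemma ptrace_pad g (rho : op R Z) :
  @ptrace R Z Y (pstr R (pad g) *o rho) = pstr R g *o @ptrace R Z Y rho.
Proof.
apply: opP => a b; rewrite ptraceE [in RHS]/opmul.
under eq_bigr do rewrite pad_opmul.
rewrite exchange_big; apply: eq_bigr => v _ /=; rewrite ptraceE big_distrr /=.
(* Overwriting the values on [Y] matches configurations restricting to [v] with those restricting to
   [a]. *)
rewrite (reindex_onto (glue a) (glue v)) /=; last by move=> s /eqP <-; rewrite glue_glue glueK.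
apply: eq_big => [s|s /andP [_ /eqP hs]].
  rewrite frestr_glue eqxx glue_glue /=.
  by apply/eqP/eqP => [<-|<-]; rewrite ?frestr_glue ?glueK.
by rewrite frestr_glue !glue_glue; rewrite glue_glue in hs; rewrite hs.
Qed.

Lemma ptraceZ k (rho : op R Z) : @ptrace R Z Y (opscale k rho) = opscale k (@ptrace R Z Y rho).
Proof. by apply: opP => a b; rewrite /opscale !ptraceE big_distrr. Qed.

Variable rho : op R Z.
Hypothesis rho1 : optr rho = 1.
Hypothesis rho_stab : forall f, optr (pstr R f *o rho) = 0 \/
  exists k, pstr R f *o rho = opscale k rho.

Definition nstab : nat := #|[set f | (psupport f \subset Y) && (optr (pstr R f *o rho) != 0)]|.

Lemma nstab_pad : nstab = #|[set g | optr (pstr R (pad g) *o rho) != 0]|.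
Proof.
rewrite -(card_imset (f := pad)); last by apply: (can_inj (g := @frestr _)) => g; exact: frestr_glue.
apply: eq_card => f; apply/idP/imsetP; rewrite inE.
  move=> /andP [/fintype.subsetP hs h]; have e : pad (frestr f) = f.
    apply: glue_ext => // z hz; rewrite ffunE; apply/esym/eqP; apply: contraR hz => hz.
    by apply: hs; rewrite inE.
  by exists (frestr f); rewrite // inE e.
move=> [g]; rewrite inE => h ->; rewrite h andbT; apply/fintype.subsetP => z.
by rewrite inE; apply: contraR => hz; rewrite glue_out // ffunE.
Qed.

Lemma nstab_gt0 : (0 < nstab)%N.
Proof.
apply/card_gt0P; exists [ffun=> 0]; rewrite inE pstr0 op1mul rho1 oner_neq0 andbT.
by apply/fintype.subsetP => z; rewrite inE ffunE.
Qed.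

(** Expand the left factor in Pauli strings. Each term tr(gM) gM is [M] when the padded [g]
    stabilizes [rho] and 0 otherwise, so the sum counts stabilizers. *)
Lemma ptrace_flat (M := @ptrace R Z Y rho) :
  M *o M = opscale (real_complex R (nstab%:R / 2 ^+ #|Y|)) M.
Proof.
have cY : #|{: SY}| = #|Y| by rewrite card_sig; apply: eq_card => z; rewrite inE.
have term g : opscale (optr (pstr R g *o M)) (pstr R g *o M) =
    opscale (optr (pstr R (pad g) *o rho) != 0)%:R M.
  rewrite -ptrace_pad optr_ptrace.
  case: (rho_stab (pad g)) => [->|[k h]].
    by rewrite eqxx; apply: opP => s t; rewrite /opscale !mul0r.
  (* The string squares to the identity and [rho] has trace 1; [k] itself is the overlap of the
     string with [rho]. *)
  have k2 : k * k = 1.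
    have : optr (pstr R (pad g) *o (pstr R (pad g) *o rho)) = 1 by rewrite opmulA pstrK op1mul.
    by rewrite h opmulZr h opscaleA optrZ rho1 mulr1.
  have k0 : k != 0 by apply/eqP => k0; move: k2; rewrite k0 mul0r => /eqP; rewrite eq_sym oner_eq0.
  by rewrite h optrZ rho1 mulr1 ptraceZ opscaleA k2 k0.
rewrite {1}[M]pauli_expansion cY opmulZl opmul_suml.
have -> : (fun s t => \sum_g ((fun s t => optr (pstr R g *o M) * pstr R g s t) *o M) s t) =
   opscale nstab%:R M.
  apply: opP => s t; rewrite nstab_pad -sum1_card natr_sum /opscale big_distrl /= [RHS]big_mkcond.
  apply: eq_bigr => g _; rewrite inE.
  transitivity (opscale (optr (pstr R g *o M)) (pstr R g *o M) s t); first by rewrite -opmulZl.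
  by rewrite term /opscale; case: (_ != 0); rewrite ?mul0r.
rewrite opscaleA; congr (opscale _ M).
by rewrite rmorphM fmorphV rmorphXn !rmorph_nat mulrC.
Qed.

Lemma entropy_stab : entropy Y rho = - log2 (nstab%:R / 2 ^+ #|Y| : R).
Proof.
rewrite /entropy; apply: vN_entropy_flat ptrace_flat _; last by rewrite optr_ptrace.
by rewrite mulf_neq0 // ?invr_eq0 ?expf_neq0 // pnatr_eq0 // -lt0n nstab_gt0.
Qed.

End Reduced.

(** * Counting stabilizers *)

Section Count.
Variable R : realType.
Local Notation C := (complex R).
Variables (P : finType) (c : seq (step R P)) (m : {ffun 'I_(nmeas c) -> bool}).
Hypotheses (vc : valid_circuit c) (Cm0 : optr (opadj (Cm m) *o Cm m) != 0).
Local Notation F := {ffun P -> 'I_4}.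
Implicit Types (f g h : F) (A B : {set P}).

Definition stab_pairs A B : {set F * F} :=
  [set p | [&& psupport p.1 \subset B, psupport p.2 \subset A & stab m p.1 p.2]].
Definition stab_image A B : {set F} :=
  [set f | (psupport f \subset A) && [exists g, (psupport g \subset B) && stab m g f]].
Definition stab_kernel B : {set F} := [set g | (psupport g \subset B) && stab m g [ffun=> 0]].

Lemma psupport0 A : psupport ([ffun=> 0] : F) \subset A.
Proof. by apply/fintype.subsetP => x; rewrite inE ffunE. Qed.

Lemma psupport_set0 f : psupport f \subset finset.set0 -> f = [ffun=> 0].
Proof.
move=> /fintype.subsetP h; apply/ffunP => x; rewrite ffunE; apply/eqP/negPn/negP => hx.
by have := h x; rewrite !inE hx => /(_ isT).
Qed.

Lemma psupport_xor f g B : psupport f \subset B -> psupport g \subset B -> psupport (pstr_xor f g) \subset B.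
Proof.
move=> /fintype.subsetP hf /fintype.subsetP hg; apply/fintype.subsetP => x; rewrite inE ffunE => h.
case: (boolP (f x == 0)) => [/eqP fx|fx]; last by apply: hf; rewrite inE.
by apply: hg; rewrite inE; move: h; rewrite fx pauli_xor_eq0 eq_sym.
Qed.

Lemma stab_eigen g f : stab m g f -> exists k : C, k != 0 /\
  pstr R g *o Cm m = opscale k (Cm m *o pstr R f).
Proof.
move=> /(stabP vc Cm0) [a [e [e2 /(_ m) h]]]; exists (parity_sign R (nmeas c) a (outcome_fun m) * e); split.
  rewrite mulf_neq0 ?parity_sign_neq0 //.
  by apply/eqP => e0; move: e2; rewrite e0 mul0r => /eqP; rewrite eq_sym oner_eq0.
by rewrite -opscaleA -h opscaleA parity_sign_sqr opscale1.
Qed.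

Lemma eigen_stab g f (k : C) : k != 0 ->
  pstr R g *o Cm m = opscale k (Cm m *o pstr R f) -> stab m g f.
Proof.
move=> k0 h; rewrite /stab -[X in optr (X *o _)]opmulA h opmulZr opmulZl optrZ.
by rewrite -!opmulA pstrK opmul1 mulf_neq0.
Qed.

(** Stabilizing pairs are closed under multiplication; the Pauli phases are nonzero and so
    harmless. *)
Lemma stab_xor g g' f f' : stab m g f -> stab m g' f' -> stab m (pstr_xor g g') (pstr_xor f f').
Proof.
move=> /stab_eigen [k [k0 h]] /stab_eigen [k' [k0' h']].
apply: (@eigen_stab _ _ ((pstr_phase R g g')^-1 * (k * k' * pstr_phase R f f'))).
  by rewrite !mulf_neq0 ?invr_eq0 ?pstr_phase_neq0.
have e (X : finType) (a b : {ffun X -> 'I_4}) : pstr R (pstr_xor a b) = opscale (pstr_phase R a b)^-1 (pstr R a *o pstr R b).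
  by rewrite pstrM opscaleA mulVf ?pstr_phase_neq0 // opscale1.
rewrite e opmulZl -opmulA h' opmulZr opmulA h opmulZl -opmulA pstrM opmulZr !opscaleA.
by congr (opscale _ _); ring.
Qed.

(** A nonempty fibre is the translate by [g0] of the fibre over the identity string. *)
Lemma card_fibre B f g0 : psupport g0 \subset B -> stab m g0 f ->
  #|[set g | (psupport g \subset B) && stab m g f]| = #|stab_kernel B|.
Proof.
move=> hB hs; have inj h : injective (fun g => pstr_xor g h).
  by apply: (can_inj (g := fun g => pstr_xor g h)) => g; exact: pstr_xorK.
rewrite -(card_imset (f := fun g => pstr_xor g g0)) //; apply: eq_card => g.
apply/imsetP/idP; rewrite inE.
  move=> [g']; rewrite inE => /andP [hg' sg'] ->.
  by rewrite psupport_xor //= -(pstr_xorff f) stab_xor.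
move=> /andP [hg sg]; exists (pstr_xor g g0); last by rewrite pstr_xorK.
rewrite inE psupport_xor //=; have := stab_xor sg hs.
suff -> : pstr_xor [ffun=> 0] f = f by [].
by apply/ffunP => x; rewrite !ffunE.
Qed.

(** Sorting the pairs by their second component gives one fibre per element of the image, all of
    equal size. *)
Lemma card_stab_pairs A B : #|stab_pairs A B| = (#|stab_image A B| * #|stab_kernel B|)%N.
Proof.
have <- : (\sum_(f in stab_image A B) #|[set g | (psupport g \subset B) && stab m g f]|)%N =
    (#|stab_image A B| * #|stab_kernel B|)%N.
  rewrite -sum_nat_const; apply: eq_bigr => f.
  by rewrite inE => /andP [_ /existsP [g0 /andP [h1 h2]]]; apply: card_fibre h1 h2.
under eq_bigr do rewrite -sum1_card.
rewrite pair_big_dep /= -sum1_card (reindex (fun p : F * F => (p.2, p.1))) /=; last first.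
  by apply: onW_bij; exists (fun p : F * F => (p.2, p.1)) => -[].
apply: eq_bigl => -[f g]; rewrite !inE /=.
apply/and3P/andP => [[h1 h2 h3]|[/andP [h2 _] /andP [h1 h3]]]; last by split.
by rewrite h1 h2 h3; split=> //; apply/existsP; exists g; rewrite h1.
Qed.

Lemma stab00 : stab m [ffun=> 0] [ffun=> 0].
Proof. by rewrite /stab pstr0 !opmul1. Qed.

Lemma stab_image_set0 B : #|stab_image finset.set0 B| = 1%N.
Proof.
apply/eqP/cards1P; exists [ffun=> 0]; apply/finset.setP => f; rewrite !inE.
apply/andP/eqP => [[/psupport_set0 -> //]|->]; rewrite psupport0; split => //.
by apply/existsP; exists [ffun=> 0]; rewrite psupport0 stab00.
Qed.

Lemma stab_kernel_set0 : #|stab_kernel finset.set0| = 1%N.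
Proof.
apply/eqP/cards1P; exists [ffun=> 0]; apply/finset.setP => f; rewrite !inE.
by apply/andP/eqP => [[/psupport_set0 -> //]|->]; rewrite psupport0 stab00.
Qed.

Lemma card_stab_image_gt0 A B : (0 < #|stab_image A B|)%N.
Proof.
apply/card_gt0P; exists [ffun=> 0]; rewrite inE psupport0.
by apply/existsP; exists [ffun=> 0]; rewrite psupport0 stab00.
Qed.

Lemma card_stab_kernel_gt0 B : (0 < #|stab_kernel B|)%N.
Proof. by apply/card_gt0P; exists [ffun=> 0]; rewrite inE psupport0 stab00. Qed.

Lemma Hcount_stab A B :
  Hcount (@chanC R P c) A
     ([set inl b | b in B] :|: [set inr k | k in [set: 'I_(nmeas c)]]) = #|stab_image A B|.
Proof.
apply: eq_card => f; rewrite !inE; congr (_ && _).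
apply/asboolP/existsP => h; first by apply/(hadj_stab vc Cm0).
exact/(hadj_stab vc Cm0).
Qed.

(** * The Choi state as a stabilizer state, and its entropies *)

Lemma optr_choi (K : op R P) :
  \sum_(s : cfg (P + P)%type) K (lpart s) (rpart s) * conjc (Cm m (lpart s) (rpart s)) =
  optr (opadj (Cm m) *o K).
Proof.
rewrite sum_ffun_join exchange_big; apply: eq_bigr => t _; apply: eq_bigr => s _ /=.
by rewrite -[lpart _]/(ffun_inl _) -[rpart _]/(ffun_inr _) ffun_joinl ffun_joinr mulrC.
Qed.

(* The reference register carries transposed Paulis, and [P_f^T = tr_sign f * P_f]. *)
Lemma pstr_phi (f : {ffun (P + P)%type -> 'I_4}) (s : cfg (P + P)%type) :
  \sum_u pstr R f s u * phi_vec m u =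
  tr_sign R (ffun_inr f) * (pstr R (ffun_inl f) *o Cm m *o pstr R (ffun_inr f)) (lpart s) (rpart s).
Proof.
rewrite sum_ffun_join exchange_big [in RHS]/opmul big_distrr; apply: eq_bigr => v _ /=.
rewrite big_distrl big_distrr; apply: eq_bigr => u _ /=.
rewrite pstr_join /phi_vec -![lpart (ffun_join _ _)]/(ffun_inl _) -![rpart (ffun_join _ _)]/(ffun_inr _) !ffun_joinl !ffun_joinr.
by rewrite (@pstr_tr R P (ffun_inr f) v); ring.
Qed.

Local Notation rho := (rho_phi m).
Local Notation nrm := (optr (opadj (Cm m) *o Cm m)).

Lemma rho_phiE s t : rho s t = phi_vec m s * conjc (phi_vec m t) / nrm.
Proof. by rewrite /rho_phi -optr_choi. Qed.

Lemma pstr_rho (f : {ffun (P + P)%type -> 'I_4}) s t : (pstr R f *o rho) s t =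
  tr_sign R (ffun_inr f) / nrm * (pstr R (ffun_inl f) *o Cm m *o pstr R (ffun_inr f)) (lpart s) (rpart s)
   * conjc (phi_vec m t).
Proof.
rewrite /opmul; under eq_bigr do rewrite rho_phiE !mulrA.
rewrite -!big_distrl /= pstr_phi /opmul; ring.
Qed.

Lemma optr_pstr_rho (f : {ffun (P + P)%type -> 'I_4}) : optr (pstr R f *o rho) =
  tr_sign R (ffun_inr f) / nrm * optr (opadj (Cm m) *o pstr R (ffun_inl f) *o Cm m *o pstr R (ffun_inr f)).
Proof.
rewrite /optr -[X in _ * X]/(optr _) -!opmulA -optr_choi big_distrr /=.
by apply: eq_bigr => s _; rewrite pstr_rho /phi_vec -!opmulA mulrA.
Qed.

Lemma rho_norm : optr rho = 1.
Proof.
have -> : optr rho = nrm / nrm; last by rewrite mulfV.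
rewrite /optr -[X in _ = X / _]/nrm -[X in _ = X / _]optr_choi big_distrl.
by apply: eq_bigr => s _; rewrite rho_phiE.
Qed.

Lemma rho_stabilizer (f : {ffun (P + P)%type -> 'I_4}) : optr (pstr R f *o rho) = 0 \/ exists k, pstr R f *o rho = opscale k rho.
Proof.
case: (boolP (stab m (ffun_inl f) (ffun_inr f))) => [/stab_eigen [k [_ h]]|/negPn /eqP h]; [right|left].
  exists (tr_sign R (ffun_inr f) * k); apply: opP => s t.
  rewrite pstr_rho h opmulZl -opmulA pstrK opmul1 /opscale rho_phiE /phi_vec; ring.
by rewrite optr_pstr_rho h mulr0.
Qed.

(** A string on system and reference is a pair of strings, and its overlap with [rho] is that of the
    pair up to a nonzero factor. *)
Lemma nstab_rho A B :
  nstab ([set inl b | b in B] :|: [set inr a | a in A]) rho = #|stab_pairs A B|.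
Proof.
rewrite -(card_imset (f := fun p : F * F => ffun_join p.1 p.2)); last first.
  by move=> [g h] [g' h'] /= e; congr pair; [rewrite -(ffun_joinl g h) e ffun_joinl|rewrite -(ffun_joinr g h) e ffun_joinr].
have e (f : {ffun (P + P)%type -> 'I_4}) : (optr (pstr R f *o rho) != 0) = stab m (ffun_inl f) (ffun_inr f).
  rewrite optr_pstr_rho mulf_eq0 negb_or /stab andbC.
  by rewrite mulf_neq0 ?andbT // ?invr_eq0 ?tr_sign_neq0.
apply: eq_card => f; rewrite inE psupport_sum e; apply/idP/imsetP.
  by move=> /andP [/andP [h1 h2] h3]; exists (ffun_inl f, ffun_inr f); rewrite ?ffun_joinK // inE /= h1 h2.
by move=> [[g h]]; rewrite inE /= => /and3P [h1 h2 h3] ->; rewrite ffun_joinl ffun_joinr h1 h2.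
Qed.

Lemma card_inlr A B :
  #|[set (inl b : P + P) | b in B] :|: [set inr a | a in A]| = (#|B| + #|A|)%N.
Proof.
rewrite cardsU !card_imset => [|? ? []//|? ? []//].
rewrite (_ : _ :&: _ = finset.set0) ?cards0 ?subn0 //.
by apply/finset.setP => z; rewrite !inE; apply/andP => -[/imsetP [? _ ->] /imsetP [? _]].
Qed.

Lemma entropy_rho A B : entropy ([set inl b | b in B] :|: [set inr a | a in A]) rho =
  - log2 (#|stab_pairs A B|%:R / 2 ^+ (#|B| + #|A|) : R).
Proof. by rewrite (entropy_stab _ rho_norm rho_stabilizer) nstab_rho card_inlr. Qed.

End Count.

(** * Logarithms and the final count *)

Lemma log2M (R : realType) (x y : R) : 0 < x -> 0 < y -> log2 (x * y) = log2 x + log2 y.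
Proof. by move=> x0 y0; rewrite /log2 lnM ?posrE // mulrDl. Qed.

Lemma log2V (R : realType) (x : R) : 0 < x -> log2 x^-1 = - log2 x.
Proof. by move=> x0; rewrite /log2 lnV ?posrE // mulNr. Qed.

Theorem theorem2 (R : realType) (P : finType) (c : seq (step R P))
  (Hc : valid_circuit c) (A B : {set P})
  (m : {ffun 'I_(nmeas c) -> bool}) (Hp : prob m != 0) :
  mutinf [set (inr a : (P + P)%type) | a in A] [set (inl b : (P + P)%type) | b in B] (rho_phi m)
  = log2 (Hcount (@chanC R P c) A
            ([set (inl b : (P + 'I_(nmeas c))%type) | b in B]
             :|: [set (inr k : (P + 'I_(nmeas c))%type) | k in [set: 'I_(nmeas c)]]))%:R
    - log2 (Hcount (@chanC R P c) A
            [set (inr k : (P + 'I_(nmeas c))%type) | k in [set: 'I_(nmeas c)]])%:R.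
Proof.
have Cm0 : optr (opadj (Cm m) *o Cm m) != 0.
  by move: Hp; rewrite /prob mulf_eq0 negb_or optrC => /andP [].
(* The register alone is the case of an empty [B]. *)
have eM : [set (inr k : (P + 'I_(nmeas c))%type) | k in [set: 'I_(nmeas c)]] =
   [set inl b | b in finset.set0] :|: [set inr k | k in [set: 'I_(nmeas c)]] by rewrite imset0 finset.set0U.
have EA := entropy_rho Hc Cm0 A finset.set0; have EB := entropy_rho Hc Cm0 finset.set0 B.
rewrite imset0 finset.set0U in EA; rewrite imset0 finset.setU0 in EB.
rewrite [in X in _ - X]eM !(Hcount_stab Hc Cm0) /mutinf finset.setUC EA EB (entropy_rho Hc Cm0).
(* The pair counts become image(A, empty) for [A], kernel(B) for [B], and image(A, B) times
   kernel(B) for the union. The kernels and the powers of 2 cancel in the mutual information. *)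
rewrite !card_stab_pairs // stab_image_set0 // stab_kernel_set0 //.
rewrite !mul1n !muln1 !cards0 addn0 add0n.
have p2 n : 0 < (2 ^+ n : R) by rewrite exprn_gt0.
have := card_stab_image_gt0 Cm0 A finset.set0; have := card_stab_image_gt0 Cm0 A B.
have := card_stab_kernel_gt0 Cm0 B.
rewrite -3!(ltr0n R) => k0 h0 a0.
rewrite natrM exprD !log2M ?invr_gt0 ?mulr_gt0 // !log2V ?mulr_gt0 // log2M //.
ring.
Qed.
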